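(* For values of the parameters $\rho=1$, $\delta_{1\rho}=\delta_{2\rho}=\pi$, any complex $z$ such that $\pi/2<\arg z<3\pi/2$, and integer real values of the parameter $\mu=n$, $n=0,\pm1,\pm2,\pm3,\dots$, the Mittag-Leffler function has the form: 1. if $n\leqslant 1$ (i.e. $n=1,0,-1,-2,-3,\dots$), then $$E_{1,n}(z)=e^{z}z^{1-n};$$ 2. if $n\geqslant 2$ (i.e. $n=2,3,4,\dots$), then $$E_{1,n}(z)=z^{1-n}\left(e^{z}-\sum_{k=0}^{n-2}\frac{z^{k}}{k!}\right).$$
   Context: The two-parameter Mittag-Leffler function is defined, for real $\rho>0$, $\mu\in\mathbb{C}$ and $z\in\mathbb{C}$, by $$E_{\rho,\mu}(z)=\sum_{k=0}^{\infty}\frac{z^{k}}{\Gamma(\mu+k/\rho)},$$ where $\Gamma$ is Euler's gamma function and $1/\Gamma(x)=0$ for $x=0,-1,-2,\dots$. The real numbers $\delta_{1\rho},\delta_{2\rho}$ are the parameters of the integration contour in the following integral representation of this function. For real $\rho>1/2$, $\epsilon>0$, $\frac{\pi}{2\rho}<\delta_{1\rho}\leqslant\min(\pi,\pi/\rho)$, $\frac{\pi}{2\rho}<\delta_{2\rho}\leqslant\min(\pi,\pi/\rho)$, any $\mu\in\mathbb{C}$ and any $z\in\mathbb{C}$ with $\frac{\pi}{2\rho}-\delta_{2\rho}+\pi<\arg z<-\frac{\pi}{2\rho}+\delta_{1\rho}+\pi$, $$E_{\rho,\mu}(z)=\frac{\rho}{2\pi i}\int_{\gamma_\zeta}\frac{\exp\{(z\zeta)^{\rho}\}(z\zeta)^{\rho(1-\mu)}}{\zeta-1}\,d\zeta,$$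 where the contour $\gamma_\zeta$ is composed of the half-line $S_1=\{\zeta:\arg\zeta=-\delta_{1\rho}-\pi,\ |\zeta|\geqslant1+\epsilon\}$, the arc $C_\epsilon=\{\zeta:-\delta_{1\rho}-\pi\leqslant\arg\zeta\leqslant\delta_{2\rho}-\pi,\ |\zeta|=1+\epsilon\}$ and the half-line $S_2=\{\zeta:\arg\zeta=\delta_{2\rho}-\pi,\ |\zeta|\geqslant1+\epsilon\}$. For $\rho=1$ and $\delta_{1\rho}=\delta_{2\rho}=\pi$ the condition on $z$ becomes $\pi/2<\arg z<3\pi/2$. *)

(* Defs.v *)
From Stdlib Require Export Reals ZArith.
From Stdlib Require Import ClassicalEpsilon.
From Coquelicot Require Export Coquelicot.

Local Open Scope C_scope.

Definition Cexp (z : C) : C := (exp (Re z) * cos (Im z), exp (Re z) * sin (Im z))%R.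

(* t^s for real t > 0, with the real logarithm of t. *)
Definition Rcpower (t : R) (s : C) : C := Cexp (s * RtoC (ln t)).

Definition CpowerZ (z : C) (n : Z) : C :=
  match n with
  | Z0 => 1
  | Zpos p => z ^ Pos.to_nat p
  | Zneg p => / z ^ Pos.to_nat p
  end.

(* theta is one of the values of the multivalued argument of z; the argument
   of 0 is undefined. *)
Definition is_arg (z : C) (theta : R) : Prop :=
  z <> 0 /\ z = RtoC (Cmod z) * (cos theta, sin theta).

(* Sum of a complex series; meaningful when the series converges. *)
Definition Csum (a : nat -> C) : C :=
  @iota C_CompleteNormedModule
    (fun s : C => @is_series C_AbsRing C_NormedModule a s).

(* Euler's integral of t^(s-1) e^(-t) over (0, +oo), convergent for Re s > 0. *)
Definition Gamma_integral (s : C) : C :=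
  @RInt_gen C_R_CompleteNormedModule
    (fun t : R => Rcpower t (s - 1) * RtoC (exp (- t)))
    (at_right 0) (Rbar_locally p_infty).

(* s (s + 1) ... (s + n - 1) *)
Fixpoint rising (s : C) (n : nat) : C :=
  match n with
  | O => 1
  | S m => rising s m * (s + RtoC (INR m))
  end.

(* A number of unit steps to the right making Re (s + shift s) > 0; it is 0
   when Re s > 0. *)
Definition shift (s : C) : nat := Z.to_nat (up (- Re s)).

(* Euler's integral continued to the complement of {0, -1, -2, ...} by the
   functional equation Gamma (s + n) = s (s + 1) ... (s + n - 1) Gamma s. *)
Definition Gamma (s : C) : C :=
  Gamma_integral (s + RtoC (INR (shift s))) / rising s (shift s).

(* 1 / Gamma, with the value 0 at the poles 0, -1, -2, ... of Gamma. *)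
Definition inv_Gamma (s : C) : C :=
  if excluded_middle_informative (exists m : nat, s = - RtoC (INR m))
  then 0 else / Gamma s.

(* E_{rho,mu}(z), for rho > 0. *)
Definition mittag_leffler (rho : R) (mu z : C) : C :=
  Csum (fun k : nat => z ^ k * inv_Gamma (mu + RtoC (INR k / rho))).

(* Main.v *)
Require Import Defs.
From Stdlib Require Import Reals ZArith Lra Lia.
From Stdlib Require Import ClassicalEpsilon.
From Coquelicot Require Import Coquelicot.

Local Open Scope C_scope.

(** For rho = 1 the coefficient of z^k is 1/Gamma(n + k) at an integer, and
    1/Gamma is known there: it vanishes at 0, -1, -2, ... and equals
    1/(p - 1)! at p >= 1 ([inv_Gamma_opp_nat], [inv_Gamma_nat]). So the
    Mittag-Leffler series is the exponential series with its index shifted.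
    If n <= 1, the first 1 - n terms vanish and the others are z^(1-n) times
    the terms of the exponential series. If n >= 2, the series is z^(1-n) times
    the tail of the exponential series from index n - 1, for z <> 0.

    Two analytic facts carry this. The Euler integral of t^m e^(-t) is m!,
    read off an explicit antiderivative ([is_RInt_gen_pow_exp_opp]). The
    exponential series converges to [Cexp] ([is_series_Cexp]): for a complex
    weight w, the real function t |-> Re (w e^(t z)) has k-th derivative
    Re (w z^k e^(t z)), so the real Taylor formula with Lagrange remainder on
    [0, 1] bounds the error; w = 1 and w = -i give real and imaginary parts. *)

(** * The exponential series *)

(** The weight w makes this family of real functions closed under
    differentiation, which replaces w by w z; all higher derivatives follow by
    iteration. *)
Lemma is_derive_Re_Cexp (w z : C) (t : R) :
  is_derive (fun t : R => Re (w * Cexp (RtoC t * z))) t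
    (Re (w * z * Cexp (RtoC t * z))).
Proof.
  destruct w as [u v], z as [a b]; unfold Cexp; simpl.
  auto_derive; [easy |].
  rewrite !Rmult_0_l, Ropp_0, Rminus_0_r, !Rplus_0_r; ring.
Qed.

Lemma is_derive_n_Re_Cexp (w z : C) (k : nat) (t : R) :
  is_derive_n (fun t : R => Re (w * Cexp (RtoC t * z))) k t
    (Re (w * z ^ k * Cexp (RtoC t * z))).
Proof.
  revert t; induction k as [|k IH]; intros t.
  - change (Re (w * Cexp (RtoC t * z)) = Re (w * 1 * Cexp (RtoC t * z))).
    now rewrite Cmult_1_r.
  - apply is_derive_ext with
      (fun t : R => Re (w * z ^ k * Cexp (RtoC t * z))).
    + intros s; symmetry; apply is_derive_n_unique, IH.
    + replace (w * z ^ S k) with (w * z ^ k * z) by (simpl; ring).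
      apply is_derive_Re_Cexp.
Qed.

Lemma Cmod_Cexp (z : C) : Cmod (Cexp z) = exp (Re z).
Proof.
  unfold Cexp, Cmod; simpl fst; simpl snd.
  replace (_ + _)%R with (exp (Re z) ^ 2)%R.
  - apply sqrt_pow2, Rlt_le, exp_pos.
  - generalize (sin2_cos2 (Im z)); unfold Rsqr; intros H.
    transitivity (exp (Re z) ^ 2 * (sin (Im z) * sin (Im z) + cos (Im z) * cos (Im z)))%R;
      [rewrite H |]; ring.
Qed.

(** The Lagrange form of the remainder at c in (0, 1) is at most
    |w| |z|^(n+1) |e^(c z)| / (n+1)!, and |e^(c z)| = e^(c Re z) is bounded
    independently of n by e^|Re z|. *)
Lemma Re_Cexp_taylor (w z : C) (n : nat) :
  (Rabs (Re (w * Cexp z)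
         - sum_f_R0 (fun k => Re (w * z ^ k) / INR (fact k)) n)
   <= Cmod w * exp (Rabs (Re z)) * (Cmod z ^ S n / INR (fact (S n))))%R.
Proof.
  destruct (Taylor_Lagrange (fun t : R => Re (w * Cexp (RtoC t * z))) n 0 1)
    as [c [Hc E]].
  - lra.
  - intros t _ [|k] _; [exact I |].
    exists (Re (w * z ^ S k * Cexp (RtoC t * z))).
    apply (is_derive_n_Re_Cexp w z (S k) t).
  - rewrite Cmult_1_l in E.
    rewrite E, (is_derive_n_unique _ _ _ _ (is_derive_n_Re_Cexp w z (S n) c)).
    rewrite (sum_eq _ (fun k => Re (w * z ^ k) / INR (fact k))%R).
    2:{ intros k _.
        rewrite (is_derive_n_unique _ _ _ _ (is_derive_n_Re_Cexp w z k 0)).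
        replace (Cexp (RtoC 0 * z)) with (RtoC 1).
        - rewrite Cmult_1_r, Rminus_0_r, pow1; field.
          apply INR_fact_neq_0.
        - unfold Cexp, RtoC; destruct z; simpl.
          rewrite !Rmult_0_l, Rplus_0_r, Rminus_0_r, exp_0, cos_0, sin_0.
          f_equal; ring. }
    rewrite Rminus_0_r, pow1.
    match goal with |- (Rabs (?s + ?r - ?s) <= _)%R =>
      replace (s + r - s)%R with r by ring end.
    rewrite Rabs_mult, (Rabs_pos_eq (1 / _)).
    2:{ apply Rlt_le, Rdiv_lt_0_compat; [lra | apply INR_fact_lt_0]. }
    assert (H : (Rabs (Re (w * z ^ S n * Cexp (RtoC c * z)))
                 <= Cmod w * exp (Rabs (Re z)) * Cmod z ^ S n)%R).
    { eapply Rle_trans; [apply re_le_Cmod |].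
      rewrite !Cmod_mult, Cmod_Cexp, Cmod_pow.
      replace (Cmod w * exp (Rabs (Re z)) * Cmod z ^ S n)%R
        with (Cmod w * Cmod z ^ S n * exp (Rabs (Re z)))%R by ring.
      apply Rmult_le_compat_l.
      - apply Rmult_le_pos; [| apply pow_le]; apply Cmod_ge_0.
      - assert (Hexp : forall x y, (x <= y -> exp x <= exp y)%R).
        { intros x y [Hxy | ->]; [left; now apply exp_increasing | right; easy]. }
        apply Hexp; rewrite re_scal_l.
        eapply Rle_trans; [apply Rle_abs |].
        rewrite Rabs_mult, (Rabs_pos_eq c) by lra.
        rewrite <- (Rmult_1_l (Rabs (Re z))) at 2.
        apply Rmult_le_compat_r; [apply Rabs_pos | lra]. }
    unfold Rdiv; rewrite Rmult_1_l, Rmult_comm, <- Rmult_assoc.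
    apply Rmult_le_compat_r; [| exact H].
    apply Rlt_le, Rinv_0_lt_compat, INR_fact_lt_0.
Qed.

Lemma is_series_Re_Cexp (w z : C) :
  is_series (fun k => Re (w * z ^ k) / INR (fact k))%R (Re (w * Cexp z)).
Proof.
  set (M := (Cmod w * exp (Rabs (Re z)))%R).
  assert (L : is_lim_seq (fun n => M * (Cmod z ^ S n / INR (fact (S n))))%R 0).
  { replace (Finite 0) with (Rbar_mult M 0) by (simpl; f_equal; ring).
    apply is_lim_seq_scal_l.
    apply (is_lim_seq_incr_1 (fun n => Cmod z ^ n / INR (fact n))%R).
    apply is_lim_seq_Reals, cv_speed_pow_fact. }
  change (is_lim_seq (sum_n (fun k => Re (w * z ^ k) / INR (fact k))%R)
            (Re (w * Cexp z))).
  apply (is_lim_seq_le_le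
    (fun n => Re (w * Cexp z) - M * (Cmod z ^ S n / INR (fact (S n))))%R _
    (fun n => Re (w * Cexp z) + M * (Cmod z ^ S n / INR (fact (S n))))%R).
  - intros n; rewrite sum_n_Reals.
    generalize (Re_Cexp_taylor w z n); fold M; intros H.
    apply Rabs_le_between in H; lra.
  - replace (Finite (Re (w * Cexp z))) with (Finite (Re (w * Cexp z) - 0))
      by (f_equal; ring).
    apply is_lim_seq_minus'; [apply is_lim_seq_const | exact L].
  - replace (Finite (Re (w * Cexp z))) with (Finite (Re (w * Cexp z) + 0))
      by (f_equal; ring).
    apply is_lim_seq_plus'; [apply is_lim_seq_const | exact L].
Qed.

(** The uniform structure on C is that of the product R * R. *)
Lemma is_series_of_Re_Im (a : nat -> C) (l : C) :
  is_series (fun k => Re (a k)) (Re l) ->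
  is_series (fun k => Im (a k)) (Im l) ->
  @is_series C_AbsRing C_NormedModule a l.
Proof.
  assert (S : forall n, sum_n a n
    = (sum_n (fun k => Re (a k)) n, sum_n (fun k => Im (a k)) n)).
  { induction n as [|n IH].
    - rewrite !sum_O; now destruct (a 0%nat).
    - rewrite !sum_Sn, IH; reflexivity. }
  intros Hr Hi P [eps HP].
  assert (Br : eventually (fun n => ball (Re l) eps (sum_n (fun k => Re (a k)) n)))
    by (apply Hr, locally_ball).
  assert (Bi : eventually (fun n => ball (Im l) eps (sum_n (fun k => Im (a k)) n)))
    by (apply Hi, locally_ball).
  unfold filtermap; generalize (filter_and _ _ Br Bi).
  apply filter_imp; intros n [B1 B2].
  apply HP; rewrite S; now split.
Qed.

Lemma is_series_Cexp (z : C) :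
  @is_series C_AbsRing C_NormedModule
    (fun k => z ^ k / RtoC (INR (fact k))) (Cexp z).
Proof.
  assert (D : forall k (x : C),
    x / RtoC (INR (fact k)) = RtoC (/ INR (fact k)) * x).
  { intros k x; unfold Cdiv.
    rewrite RtoC_inv by apply INR_fact_neq_0; ring. }
  apply is_series_of_Re_Im.
  - generalize (is_series_Re_Cexp 1 z); rewrite Cmult_1_l.
    apply is_series_ext; intros k.
    rewrite Cmult_1_l, D, re_scal_l; apply Rmult_comm.
  - (* Im x = Re (- i x): the weight - i selects the imaginary part. *)
    assert (ReIm : forall x : C, Re (- Ci * x) = Im x)
      by (intros [x y]; simpl; ring).
    generalize (is_series_Re_Cexp (- Ci) z); rewrite ReIm.
    apply is_series_ext; intros k.
    rewrite ReIm, D, im_scal_l; apply Rmult_comm.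
Qed.

(** * Values of the Gamma function at the integers *)

(** The recursion is integration by parts: the antiderivative of t^m e^(-t)
    that tends to 0 at +oo. *)
Fixpoint Gamma_primitive (m : nat) (t : R) : R :=
  match m with
  | O => - exp (- t)
  | S p => - (t ^ S p * exp (- t)) + INR (S p) * Gamma_primitive p t
  end%R.

Lemma is_derive_Gamma_primitive (m : nat) (t : R) :
  is_derive (Gamma_primitive m) t (t ^ m * exp (- t))%R.
Proof.
  induction m as [|m IH].
  - simpl; auto_derive; [easy | ring].
  - apply (is_derive_ext (fun t => plus (- (t ^ S m * exp (- t)))%R
                               (scal (INR (S m)) (Gamma_primitive m t)))).
    { reflexivity. }
    replace (t ^ S m * exp (- t))%R with
      (plus (t ^ S m * exp (- t) - INR (S m) * t ^ m * exp (- t))%R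
            (scal (INR (S m)) (t ^ m * exp (- t))%R))
      by (unfold plus, scal; simpl; unfold mult; simpl; ring).
    apply @is_derive_plus; [| now apply is_derive_scal].
    auto_derive; [easy |].
    change (Init.Nat.pred (S m)) with m.
    change (match m with 0%nat => 1%R | S _ => (INR m + 1)%R end)
      with (INR (S m)).
    simpl pow; ring.
Qed.

Lemma Gamma_primitive_0 (m : nat) : Gamma_primitive m 0 = (- INR (fact m))%R.
Proof.
  induction m as [|m IH].
  - simpl; rewrite Ropp_0, exp_0; ring.
  - simpl Gamma_primitive; rewrite IH, fact_simpl, mult_INR.
    change (match m with 0%nat => 1%R | S _ => (INR m + 1)%R end)
      with (INR (S m)); ring.
Qed.

(** The Taylor bound t^(m+1) / (m+1)! <= e^t gives
    0 <= t^m e^(-t) <= (m+1)! / t for t > 0. *)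
Lemma is_lim_pow_exp_opp (m : nat) :
  is_lim (fun t => t ^ m * exp (- t))%R p_infty 0.
Proof.
  apply (is_lim_le_le_loc (fun _ => 0%R) (fun t => INR (fact (S m)) * / t)%R).
  - exists 0%R; intros t Ht.
    assert (E : (t ^ S m / INR (fact (S m)) <= exp t)%R).
    { eapply Rle_trans; [| apply (exp_ge_taylor t (S m)); lra].
      rewrite tech5.
      rewrite <- (Rplus_0_l (t ^ S m / _)) at 1.
      apply Rplus_le_compat_r, cond_pos_sum; intros k.
      apply Rle_div_r; [apply INR_fact_lt_0 |].
      rewrite Rmult_0_l; apply pow_le; lra. }
    split.
    + apply Rmult_le_pos; [apply pow_le; lra | apply Rlt_le, exp_pos].
    + rewrite exp_Ropp.
      apply Rle_div_l; [apply exp_pos |].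
      apply Rle_div_l in E; [| apply INR_fact_lt_0].
      replace (t ^ m)%R with (t ^ S m / t)%R by (simpl; field; lra).
      apply Rle_div_l; [exact Ht |].
      eapply Rle_trans; [exact E |]. right; field; lra.
  - apply is_lim_const.
  - replace (Finite 0) with (Rbar_mult (INR (fact (S m))) 0)
      by (simpl; f_equal; ring).
    apply is_lim_scal_l.
    replace (Finite 0) with (Rbar_inv p_infty) by reflexivity.
    apply is_lim_inv; [apply is_lim_id | discriminate].
Qed.

Lemma is_lim_Gamma_primitive (m : nat) :
  is_lim (Gamma_primitive m) p_infty 0.
Proof.
  induction m as [|m IH].
  - apply (is_lim_ext (fun t => - (t ^ 0 * exp (- t)))%R).
    { intros t; simpl; ring. }
    replace (Finite 0) with (Rbar_opp 0) by (simpl; f_equal; ring).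
    apply is_lim_opp, is_lim_pow_exp_opp.
  - simpl Gamma_primitive.
    replace (Finite 0) with (Finite (- 0 + INR (S m) * 0)) by (f_equal; ring).
    apply is_lim_plus'.
    + apply (is_lim_opp _ p_infty 0), (is_lim_pow_exp_opp (S m)).
    + apply (is_lim_scal_l _ (INR (S m)) p_infty 0), IH.
Qed.

Lemma is_RInt_gen_pow_exp_opp (m : nat) :
  is_RInt_gen (fun t => t ^ m * exp (- t))%R (at_right 0) (Rbar_locally p_infty)
    (INR (fact m)).
Proof.
  assert (D : forall t, Derive (Gamma_primitive m) t = (t ^ m * exp (- t))%R)
    by (intros t; apply is_derive_unique, is_derive_Gamma_primitive).
  apply (is_RInt_gen_ext (Derive (Gamma_primitive m))).
  { apply filter_forall; intros ab t _; apply D. }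
  replace (INR (fact m)) with (0 - - INR (fact m))%R by ring.
  apply is_RInt_gen_Derive.
  - apply filter_forall; intros ab t _; eexists; apply is_derive_Gamma_primitive.
  - apply filter_forall; intros ab t _.
    apply (continuous_ext (fun t => t ^ m * exp (- t))%R).
    { intros s; symmetry; apply D. }
    apply @ex_derive_continuous; auto_derive; easy.
  - rewrite <- Gamma_primitive_0.
    apply (filterlim_filter_le_1 (F := locally 0%R)).
    + apply filter_le_within; typeclasses eauto.
    + apply @ex_derive_continuous; eexists; apply is_derive_Gamma_primitive.
  - apply is_lim_Gamma_primitive.
Qed.

Lemma is_RInt_gen_RtoC (f : R -> R) (Fa Fb : (R -> Prop) -> Prop)
  {FFa : Filter Fa} {FFb : Filter Fb} (l : R) :
  is_RInt_gen f Fa Fb l ->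
  @is_RInt_gen C_R_NormedModule (fun t => RtoC (f t)) Fa Fb (RtoC l).
Proof.
  intros H P [eps HP].
  assert (HQ : locally l (fun y => P (RtoC y))).
  { exists eps; intros y Hy; apply HP; split; [exact Hy | apply ball_center]. }
  generalize (H _ HQ); unfold filtermapi; apply filter_imp.
  intros [a b] [y [Iy Py]]; exists (RtoC y); split; [| exact Py].
  apply @is_RInt_fct_extend_pair; [exact Iy |].
  generalize (is_RInt_const (V := R_NormedModule) a b 0%R).
  now replace (scal (b - a)%R (0%R : R_NormedModule)) with 0%R
    by (symmetry; apply Rmult_0_r).
Qed.

Lemma Gamma_integral_nat (m : nat) :
  Gamma_integral (RtoC (INR (S m))) = RtoC (INR (fact m)).
Proof.
  unfold Gamma_integral.
  apply (is_RInt_gen_unique (V := C_R_CompleteNormedModule)).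
  apply (is_RInt_gen_ext (V := C_R_NormedModule)
           (fun t => RtoC (t ^ m * exp (- t)))).
  - exists (fun a => (0 < a)%R) (fun b => (0 < b)%R).
    + exists (mkposreal 1 Rlt_0_1); intros y _ Hy; exact Hy.
    + exists 0%R; easy.
    + intros a b Ha Hb t [Ht _]; simpl in Ht.
      assert (Pt : (0 < t)%R)
        by (eapply Rlt_trans; [| exact Ht]; now apply Rmin_glb_lt).
      rewrite RtoC_mult; f_equal.
      unfold Rcpower, Cexp.
      replace (RtoC (INR (S m)) - 1) with (RtoC (INR m))
        by (rewrite <- RtoC_minus, S_INR; f_equal; ring).
      rewrite <- RtoC_mult; simpl.
      rewrite cos_0, sin_0, <- ln_pow, exp_ln by (auto; now apply pow_lt).
      unfold RtoC; f_equal; ring.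
  - apply is_RInt_gen_RtoC; try typeclasses eauto.
    apply is_RInt_gen_pow_exp_opp.
Qed.

(** At a positive integer, Gamma is the Euler integral itself: no unit steps to
    the right are taken. *)
Lemma inv_Gamma_nat (m : nat) :
  inv_Gamma (RtoC (INR (S m))) = / RtoC (INR (fact m)).
Proof.
  unfold inv_Gamma.
  destruct excluded_middle_informative as [[p E] |_].
  - exfalso. rewrite <- RtoC_opp in E; apply RtoC_inj in E.
    rewrite S_INR in E; generalize (pos_INR m) (pos_INR p); lra.
  - f_equal; unfold Gamma.
    replace (Defs.shift (RtoC (INR (S m)))) with 0%nat.
    + simpl rising. simpl (INR 0). rewrite Cplus_0_r, Gamma_integral_nat.
      field.
    + unfold Defs.shift; rewrite re_RtoC.
      destruct (archimed (- INR (S m))) as [_ H].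
      assert (up (- INR (S m)) < 1)%Z.
      { apply lt_IZR. rewrite S_INR in *; generalize (pos_INR m); lra. }
      lia.
Qed.

Lemma inv_Gamma_opp_nat (m : nat) : inv_Gamma (RtoC (- INR m)) = 0.
Proof.
  unfold inv_Gamma.
  destruct excluded_middle_informative as [_ | H]; [easy |].
  exfalso; apply H; exists m; apply RtoC_opp.
Qed.

(** * The shifted exponential series *)

Lemma Csum_unique (a : nat -> C) (l : C) :
  @is_series C_AbsRing C_NormedModule a l -> Csum a = l.
Proof.
  intros H; unfold Csum, is_series.
  apply (iota_filterlim_locally (V := C_CompleteNormedModule)), H.
Qed.

Lemma CpowerZ_of_nat (z : C) (m : nat) : CpowerZ z (Z.of_nat m) = z ^ m.
Proof.
  destruct m as [|m]; [reflexivity |].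
  simpl Z.of_nat; unfold CpowerZ; now rewrite SuccNat2Pos.id_succ.
Qed.

Lemma CpowerZ_opp_of_nat (z : C) (m : nat) :
  CpowerZ z (- Z.of_nat (S m)) = / z ^ S m.
Proof.
  simpl Z.of_nat; unfold CpowerZ; simpl Z.opp; cbv iota.
  now rewrite SuccNat2Pos.id_succ.
Qed.

(** The arguments 1 - m, ..., 0 of 1/Gamma, reached for k < m, are poles of
    Gamma; from k = m on, the coefficients are those of the exponential
    series. *)
Lemma mittag_leffler_1_le_1 (z : C) (m : nat) :
  mittag_leffler 1 (RtoC (1 - INR m)) z = Cexp z * z ^ m.
Proof.
  apply Csum_unique.
  set (a := fun k : nat => _).
  assert (A0 : forall k, (k < m)%nat -> a k = 0).
  { intros k Hk; unfold a.
    replace (RtoC (1 - INR m) + RtoC (INR k / 1)) with (RtoC (- INR (m - 1 - k))).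
    - rewrite inv_Gamma_opp_nat; ring.
    - rewrite <- RtoC_plus, !minus_INR by lia; f_equal; simpl; field. }
  assert (A1 : @is_series C_AbsRing C_NormedModule
                 (fun k => a (m + k)%nat) (Cexp z * z ^ m)).
  { rewrite Cmult_comm.
    generalize (is_series_scal (V := C_NormedModule) (z ^ m) _ _ (is_series_Cexp z)).
    apply is_series_ext; intros k; unfold a.
    replace (RtoC (1 - INR m) + RtoC (INR (m + k) / 1)) with (RtoC (INR (S k))).
    - rewrite inv_Gamma_nat, Cpow_add_r; apply Cmult_assoc.
    - rewrite <- RtoC_plus, plus_INR, S_INR; f_equal; field. }
  (* [is_series_decr_n] restores at least one term, hence the case m = 0. *)
  destruct m as [|m]; [exact A1 |].
  apply (is_series_decr_n a (S m)); [lia |].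
  replace (plus _ _) with (Cexp z * z ^ S m); [exact A1 |].
  simpl Init.Nat.pred.
  rewrite (sum_n_ext_loc _ (fun _ => zero : C_NormedModule)).
  - unfold sum_n; rewrite sum_n_m_const_zero.
    change (Cexp z * z ^ S m = Cexp z * z ^ S m - 0); ring.
  - intros k Hk; apply A0; lia.
Qed.

(** With n = m + 2, the k-th term z^k / (m+1+k)! is z^(-(m+1)) times the
    (m+1+k)-th term of the exponential series, so only the tail from index m+1
    is summed. *)
Lemma mittag_leffler_1_ge_2 (z : C) (m : nat) :
  z <> 0 ->
  mittag_leffler 1 (RtoC (INR (S (S m)))) z =
    / z ^ S m *
      (Cexp z - sum_n (fun k : nat => z ^ k / RtoC (INR (fact k))) m).
Proof.
  intros Hz; apply Csum_unique.
  set (b := fun k : nat => z ^ k / RtoC (INR (fact k))).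
  assert (B : @is_series C_AbsRing C_NormedModule
                (fun k => b (S m + k)%nat) (Cexp z - sum_n b m)).
  { apply is_series_incr_n; [lia |].
    replace (plus _ _) with (Cexp z); [apply is_series_Cexp |].
    change (Cexp z = Cexp z - sum_n b m + sum_n b m); ring. }
  generalize (is_series_scal (V := C_NormedModule) (/ z ^ S m) _ _ B).
  apply is_series_ext; intros k.
  change (/ z ^ S m * b (S m + k)%nat = z ^ k *
    inv_Gamma (RtoC (INR (S (S m))) + RtoC (INR k / 1))).
  replace (RtoC (INR (S (S m))) + RtoC (INR k / 1))
    with (RtoC (INR (S (S m + k)))).
  - rewrite inv_Gamma_nat; unfold b; rewrite Cpow_add_r; unfold Cdiv.
    rewrite !Cmult_assoc, Cinv_l; [ring | now apply Cpow_nz].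
  - rewrite <- RtoC_plus; f_equal.
    rewrite !S_INR, plus_INR, S_INR; field.
Qed.

Theorem corollary1 (z : C) (n : Z)
  (hz : exists theta : R, is_arg z theta /\ (PI / 2 < theta < 3 * PI / 2)%R) :
  ((n <= 1)%Z ->
     mittag_leffler 1 (RtoC (IZR n)) z = Cexp z * CpowerZ z (1 - n)) /\
  ((2 <= n)%Z ->
     mittag_leffler 1 (RtoC (IZR n)) z =
       CpowerZ z (1 - n) *
         (Cexp z -
            sum_n (fun k : nat => z ^ k / RtoC (INR (fact k)))
                  (Z.to_nat (n - 2)))).
Proof.
  destruct hz as [theta [[Hz _] _]].
  split; intros Hn.
  - destruct (Z_of_nat_complete (1 - n)) as [m Hm]; [lia |].
    rewrite Hm, CpowerZ_of_nat, <- mittag_leffler_1_le_1.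
    do 2 f_equal. rewrite INR_IZR_INZ, <- Hm, <- minus_IZR; f_equal; lia.
  - destruct (Z_of_nat_complete (n - 2)) as [m Hm]; [lia |].
    replace (1 - n)%Z with (- Z.of_nat (S m))%Z by lia.
    rewrite Hm, Nat2Z.id, CpowerZ_opp_of_nat, <- mittag_leffler_1_ge_2 by easy.
    do 2 f_equal. rewrite INR_IZR_INZ; f_equal; lia.
Qed.
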